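(* Let $G=(V,E)$ be a finite connected graph. Then for Lebesgue-almost every $Q\in\mathbb{R}^V$, the operator $H_Q=\Delta_G+Q$ does Schrödinger phase retrieval: for every $T>0$, whenever $u_0,v_0\in\mathbb{C}^V$ satisfy $|(e^{-itH_Q}u_0)(j)|=|(e^{-itH_Q}v_0)(j)|$ for all $t\in[0,T]$ and all $j\in V$, there is $c\in\mathbb{C}$ with $|c|=1$ such that $u_0=c\,v_0$.
   Context: $G=(V,E)$ is a finite simple undirected graph. Its combinatorial Laplacian is $\Delta_G u(j)=\sum_{k\sim j}(u(j)-u(k))$ for $u\in\mathbb{C}^V$. A potential $Q\in\mathbb{R}^V$ is identified with the diagonal operator $(Qu)(j)=Q(j)u(j)$, and $H_Q=\Delta_G+Q$. *)

(* Defs.v *)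
From HB Require Import structures.
From mathcomp Require Import all_boot all_order all_algebra.
From mathcomp Require Import complex.
From mathcomp Require Import all_classical all_reals all_analysis.

Set Implicit Arguments.
Unset Strict Implicit.
Unset Printing Implicit Defensive.

Import Order.TTheory GRing.Theory Num.Theory.
Import numFieldNormedType.Exports.

Local Open Scope classical_set_scope.
Local Open Scope complex_scope.
Local Open Scope ring_scope.

Section TupleMeasure.
Context d (T : measurableType d) (R : realType).
Variable m : {sigma_finite_measure set T -> \bar R}.

Definition tuple_cons n (p : T * n.-tuple T) : n.+1.-tuple T :=
  [the n.+1.-tuple T of p.1 :: p.2].

Lemma measurable_tuple_cons n : measurable_fun setT (@tuple_cons n).
Proof. exact: measurable_cons. Qed.

Section Cons.
Context n (mu : {sigma_finite_measure set (n.-tuple T) -> \bar R}).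

Definition cons_measure : set (n.+1.-tuple T) -> \bar R :=
  pushforward (m \x mu)%E (@tuple_cons n).

Let mcons := @measurable_tuple_cons n.

Let cons_measure0 : cons_measure set0 = 0%E.
Proof. exact: measure0. Qed.

Let cons_measure_ge0 A : (0 <= cons_measure A)%E.
Proof. exact: measure_ge0. Qed.

Let cons_measure_sigma_additive : semi_sigma_additive cons_measure.
Proof. exact: measure_semi_sigma_additive. Qed.

HB.instance Definition _ := isMeasure.Build _ _ _ cons_measure
  cons_measure0 cons_measure_ge0 cons_measure_sigma_additive.

Let cons_measure_sigma_finite : sigma_finite setT cons_measure.
Proof.
have /sigma_finiteP[F [TF ndF Foo]] := sigma_finiteT m.
have /sigma_finiteP[G [TG ndG Goo]] := sigma_finiteT mu.
have mbehead : measurable_fun setT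
    (fun x : n.+1.-tuple T => [tuple of behead x]) by exact: measurable_behead.
exists (fun k => [set x : n.+1.-tuple T |
    F k (tnth x ord0) /\ G k [tuple of behead x]]).
  apply/seteqP; split => // x _.
  have [i _ Fi] : (\bigcup_i F i) (tnth x ord0) by rewrite -TF.
  have [j _ Gj] : (\bigcup_i G i) [tuple of behead x] by rewrite -TG.
  exists (maxn i j) => //=; split.
  - by move: (tnth x ord0) Fi; exact/subsetPset/ndF/leq_maxl.
  - by move: [tuple of behead x] Gj; exact/subsetPset/ndG/leq_maxr.
move=> k; have [mF Fk] := Foo k; have [mG Gk] := Goo k; split.
  apply: measurableI.
    by rewrite -[X in measurable X]setTI; exact: measurable_tnth.
  by rewrite -[X in measurable X]setTI; exact: mbehead.
rewrite /cons_measure /pushforward [X in (m \x mu)%E X](_ : _ = F k `*` G k).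
  by rewrite product_measure1E// lte_mul_pinfty// ge0_fin_numE.
apply/seteqP; split => -[x t] /=.
  by rewrite (_ : [tuple of _] = t); last exact/val_inj.
by rewrite (_ : [tuple of _] = t); last exact/val_inj.
Qed.

HB.instance Definition _ := Measure_isSigmaFinite.Build _ _ _
  cons_measure cons_measure_sigma_finite.

End Cons.

Fixpoint tuple_measure n : {sigma_finite_measure set (n.-tuple T) -> \bar R} :=
  match n with
  | 0 => \d_[tuple]
  | n'.+1 => cons_measure (tuple_measure n')
  end.

Lemma tuple_measure_box n (A : 'I_n -> set T) :
  (forall i, measurable (A i)) ->
  tuple_measure n [set x | forall i, A i (tnth x i)] = (\prod_(i < n) m (A i))%E.
Proof.
elim: n A => [|n IHn] A mA.
  rewrite big_ord0 /= diracE mem_set//= => -[].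
  done.
rewrite big_ord_recl /= /cons_measure /pushforward.
rewrite [X in (m \x _)%E X](_ : _ = A ord0 `*`
    [set x | forall i, A (lift ord0 i) (tnth x i)]); last first.
  apply/seteqP; split => [[x t] /= h|[x t] /= [h0 h] i].
    split=> [|i]; first exact: (h ord0).
    by have := h (lift ord0 i); rewrite tnthS.
  by case: (unliftP ord0 i) => [j ->|->] //; rewrite tnthS.
have mB : measurable [set x : n.-tuple T | forall i, A (lift ord0 i) (tnth x i)].
  rewrite [X in measurable X](_ : _ =
    \bigcap_(i in [set: 'I_n]) ((@tnth n T)^~ i @^-1` A (lift ord0 i))).
    apply: fin_bigcap_measurable => // i _.
    by rewrite -[X in measurable X]setTI; exact: measurable_tnth.
  by apply/seteqP; split => [x h i _|x h i] //=; exact: h.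
rewrite product_measure1E//; congr (_ * _)%E.
exact: (IHn (fun i => A (lift ord0 i))).
Qed.

End TupleMeasure.

(* Lebesgue measure on R^n, the n-fold product of the one-dimensional one. *)
Definition lebesgue_measure_tuple (R : realType) (n : nat) :
    {sigma_finite_measure set (n.-tuple (measurableTypeR R)) -> \bar R} :=
  tuple_measure (@lebesgue_measure R) n.

Section SchrodingerFlow.
Context {R : realType} {V : finType}.
Local Notation state := {ffun V -> R[i]}.

Definition simple_graph (e : rel V) : Prop := symmetric e /\ irreflexive e.

Definition connected_graph (e : rel V) : Prop := forall x y : V, connect e x y.

Definition laplacian (e : rel V) (u : state) : state :=
  [ffun j => \sum_(k | e j k) (u j - u k)].

(* R^#|V| and R^V are identified through the enumeration of V. *)
Definition potential (q : #|V|.-tuple (measurableTypeR R)) : {ffun V -> R} :=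
  [ffun j => tnth q (enum_rank j)].

Definition schrodinger (e : rel V) (Q : {ffun V -> R}) (u : state) : state :=
  [ffun j => laplacian e u j + (Q j)%:C * u j].

(* e^A u = \sum_k A^k u / k!, for a linear operator A on C^V; the limit is taken
   coordinatewise, for the topology of the modulus on C (the role of ^o). *)
Definition operator_exp (A : state -> state) (u : state) : state :=
  [ffun j => (limn (fun n : nat =>
     (\sum_(0 <= k < n) (k`!%:R)^-1 * iter k A u j : R[i]^o)) : R[i])].

Definition evolution (H : state -> state) (t : R) : state -> state :=
  operator_exp (fun u => (- 'i * t%:C) *: H u).

Definition schrodinger_phase_retrieval (H : state -> state) : Prop :=
  forall T : R, 0 < T ->
  forall u0 v0 : state,
    (forall t : R, 0 <= t <= T -> forall j : V,
       `|evolution H t u0 j| = `|evolution H t v0 j|) ->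
    exists c : R[i], `|c| = 1 /\ u0 = c *: v0.

End SchrodingerFlow.

(* Main.v *)
(* Write H = U L U^* with U unitary and L = diag(l_k). Then
   |u_j(t)|^2 - |v_j(t)|^2 is a trigonometric sum with frequencies l_k' - l_k and
   coefficients U_jk conj(U_jk') (a_k conj(a_k') - b_k conj(b_k')), where a, b are
   the coordinates of u_0, v_0 in the eigenbasis. If it vanishes on [0, T] and
   (B) the differences l_k - l_k', k <> k', are pairwise distinct, then each
   off-diagonal coefficient vanishes, and so does the sum of the diagonal ones.
   If moreover (A) no eigenvector vanishes at some fixed vertex j0 and (C) the
   matrix (|U_jk|^2) is invertible, then a_k conj(a_k') = b_k conj(b_k') for all
   k, k', that is, u_0 = c v_0.

   Each of these conditions follows from the nonvanishing of a determinant that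
   is polynomial in Q: the Krylov matrix of the basis vector at j0 for (A), the
   Hankel matrix of the traces of the powers of X |-> H X - X H for (B), and the
   matrix ((H^m)_jj) for (C). Zero sets of nonzero polynomials are null, so it
   remains to find for each determinant one Q where it does not vanish. For (B)
   and (C) take Q = d / eps for small eps, which reduces to a diagonal H. For (A)
   conjugate eps H by diag((-eps)^h), with h the graph distance to j0: the limit
   eps -> 0 is triangular with respect to h, and its left eigenvectors have a
   positive entry at j0 because G is connected. *)
Require Import Defs.
From mathcomp Require Import all_boot all_order all_algebra.
From mathcomp Require Import complex.
From mathcomp Require Import all_classical all_reals all_analysis.
From mathcomp Require Import measurable_realfun.
From mathcomp Require Import ring zify.

Set Implicit Arguments.
Unset Strict Implicit.
Unset Printing Implicit Defensive.

Import Order.TTheory GRing.Theory Num.Theory.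
Import numFieldNormedType.Exports.

Local Open Scope classical_set_scope.
Local Open Scope ring_scope.

(** * Polynomial functions and their zero sets *)

Section PolynomialFunctions.
Context {R : realType}.

(** The algebra of functions generated by the family [g]: polynomials on R^n when [g] is the family
    of coordinates, polynomials in one variable when [g] is the identity indexed by [unit]. *)
Inductive polyfun (I T : Type) (g : I -> T -> R) : (T -> R) -> Prop :=
| polyfun_cst c : polyfun g (fun=> c)
| polyfun_gen i : polyfun g (g i)
| polyfunD f1 f2 : polyfun g f1 -> polyfun g f2 ->
    polyfun g (fun x => f1 x + f2 x)
| polyfunM f1 f2 : polyfun g f1 -> polyfun g f2 ->
    polyfun g (fun x => f1 x * f2 x).

Lemma polyfun_comp (I I' T T' : Type) (g : I -> T -> R) (g' : I' -> T' -> R)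
    (phi : T' -> T) (f : T -> R) :
  (forall i, polyfun g' (g i \o phi)) -> polyfun g f -> polyfun g' (f \o phi).
Proof.
move=> gphi; elim=> [c|i|f1 f2 _ h1 _ h2|f1 f2 _ h1 _ h2] //.
- exact: polyfun_cst.
- exact: (polyfunD h1 h2).
- exact: (polyfunM h1 h2).
Qed.

Lemma polyfun_horner (f : R -> R) :
  polyfun (fun (_ : unit) x => x) f -> exists p : {poly R}, f = horner p.
Proof.
elim=> [c|_|f1 f2 _ [p1 ->] _ [p2 ->]|f1 f2 _ [p1 ->] _ [p2 ->]].
- by exists c%:P; apply/funext => x; rewrite hornerC.
- by exists 'X; apply/funext => x; rewrite hornerX.
- by exists (p1 + p2); apply/funext => x; rewrite hornerD.
- by exists (p1 * p2); apply/funext => x; rewrite hornerM.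
Qed.

Section Closure.
Context (I T : Type) (g : I -> T -> R).

Lemma polyfun_sum (J : Type) (r : seq J) (P : pred J) (F : J -> T -> R) :
  (forall j, polyfun g (F j)) -> polyfun g (fun x => \sum_(j <- r | P j) F j x).
Proof.
move=> gF; elim: r => [|j r IHr].
  rewrite [X in polyfun _ X](_ : _ = fun=> 0); first exact: polyfun_cst.
  by apply/funext => x; rewrite big_nil.
rewrite [X in polyfun _ X](_ : _ = fun x => (P j)%:R * F j x +
  \sum_(j <- r | P j) F j x).
  exact/polyfunD/IHr/polyfunM/gF/polyfun_cst.
apply/funext => x; rewrite big_cons.
by case: ifP => _; rewrite ?mul1r// mul0r add0r.
Qed.

Lemma polyfun_prod (J : Type) (r : seq J) (F : J -> T -> R) :
  (forall j, polyfun g (F j)) -> polyfun g (fun x => \prod_(j <- r) F j x).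
Proof.
move=> gF; elim: r => [|j r IHr].
  rewrite [X in polyfun _ X](_ : _ = fun=> 1); first exact: polyfun_cst.
  by apply/funext => x; rewrite big_nil.
rewrite [X in polyfun _ X](_ : _ = fun x => F j x * \prod_(j <- r) F j x).
  exact: polyfunM.
by apply/funext => x; rewrite big_cons.
Qed.

Definition polymx m n (M : T -> 'M[R]_(m, n)) :=
  forall i j, polyfun g (fun x => M x i j).

Lemma polymx_exp n (M : T -> 'M[R]_n) k :
  polymx M -> polymx (fun x => M x ^+ k).
Proof.
move=> gM; elim: k => [|k IHk] i j.
  rewrite [X in polyfun _ X](_ : _ = fun=> (i == j)%:R); first exact: polyfun_cst.
  by apply/funext => x; rewrite expr0 mxE.
rewrite [X in polyfun _ X](_ : _ = fun x => \sum_l M x i l * (M x ^+ k) l j).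
  by apply: polyfun_sum => l; apply: polyfunM; [exact: gM|exact: IHk].
by apply/funext => x; rewrite exprS mxE.
Qed.

Lemma polyfun_tr n (M : T -> 'M[R]_n) :
  polymx M -> polyfun g (fun x => \tr (M x)).
Proof. by move=> gM; apply: polyfun_sum => i; exact: gM. Qed.

Lemma polyfun_det n (M : T -> 'M[R]_n) :
  polymx M -> polyfun g (fun x => \det (M x)).
Proof.
move=> gM; apply: polyfun_sum => s; apply: polyfunM; first exact: polyfun_cst.
by apply: polyfun_prod => i; exact: gM.
Qed.

End Closure.

Definition tuple_coord n (i : 'I_n) (x : n.-tuple (measurableTypeR R)) : R :=
  tnth x i.

Lemma measurable_polyfun n (f : n.-tuple (measurableTypeR R) -> R) :
  polyfun (@tuple_coord n) f -> measurable_fun setT f.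
Proof.
elim=> [c|i|f1 f2 _ h1 _ h2|f1 f2 _ h1 _ h2].
- exact: measurable_cst.
- exact: measurable_tnth.
- exact: measurable_funD.
- exact: measurable_funM.
Qed.

Lemma measurable_polyfun_zeros n (f : n.-tuple (measurableTypeR R) -> R) :
  polyfun (@tuple_coord n) f -> measurable [set x | f x = 0].
Proof.
move=> /measurable_polyfun mf.
have := mf measurableT [set 0] (measurable_set1 _); rewrite setTI.
by congr measurable; apply/seteqP; split.
Qed.

Lemma countable_roots (p : {poly R}) : p != 0 -> countable [set x | p.[x] = 0].
Proof.
move=> p0; apply: finite_set_countable; apply: contrapT.
move=> /(infinite_set_fset (size p))[B Bp].
rewrite leqNgt => /negP; apply.
apply: max_poly_roots => //; last exact: finmap.fset_uniq.
by apply/allP => x xB; apply/eqP/Bp.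
Qed.

(** Fubini and induction on [n]. Along the line through [p] in the first coordinate, [f] is a
    one-variable polynomial [q], nonzero because of [p]. Away from the countably many roots of [q],
    the slice of [f] does not vanish at the tail of [p], so its zero set is null by induction. *)
Lemma polyfun_zeros_null n (f : n.-tuple (measurableTypeR R) -> R) p :
  polyfun (@tuple_coord n) f -> f p != 0 ->
  lebesgue_measure_tuple R n [set x | f x = 0] = 0%E.
Proof.
elim: n f p => [|n IHn] f p gf fp0.
  rewrite /lebesgue_measure_tuple/= diracE memNset//= => f0.
  by move: fp0; rewrite (tuple0 p) f0 eqxx.
have mZ := measurable_polyfun_zeros gf.
have [q qE] : exists q : {poly R},
    (fun x => f [tuple of x :: behead p]) = horner q.
  apply: polyfun_horner.
  apply: (polyfun_comp (phi := fun x => [tuple of x :: behead p])) gf => i.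
  case: (unliftP ord0 i) => [j ->|->].
    rewrite [X in polyfun _ X](_ : _ = fun=> tnth [tuple of behead p] j).
      exact: polyfun_cst.
    by apply/funext => x; rewrite /tuple_coord /= tnthS.
  exact: (polyfun_gen _ tt).
have q0 : q != 0.
  apply: contra fp0 => /eqP q0; have := congr1 (@^~ (thead p)) qE.
  by rewrite q0 horner0 => <-; rewrite -tuple_eta.
pose m := tuple_measure (@lebesgue_measure R) n.
have mZ' : measurable (@tuple_cons _ (measurableTypeR R) n @^-1` [set x | f x = 0]).
  by rewrite -[X in measurable X]setTI; exact: (measurable_tuple_cons _ mZ).
have mphi := measurable_fun_xsection m mZ'.
rewrite /lebesgue_measure_tuple /= /cons_measure /pushforward /product_measure1.
rewrite (ae_eq_integral (cst 0%E)) ?integral0//.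
exists [set x | q.[x] = 0]; split.
- by apply: countable_measurable => //; exact: countable_roots.
- by apply: countable_lebesgue_measure0; exact: countable_roots.
move=> x /= /not_implyP[_ nx]; apply: contrapT => qx; apply: nx.
rewrite -(IHn (fun y => f [tuple of x :: y]) [tuple of behead p]).
- by rewrite /lebesgue_measure_tuple; congr (_ _); apply/seteqP; split => y;
    rewrite /xsection /= inE.
- refine (@polyfun_comp _ _ _ _ _ (@tuple_coord n)
    (fun y => [tuple of x :: y]) f _ gf).
  move=> i; case: (unliftP ord0 i) => [j ->|->].
    rewrite [X in polyfun _ X](_ : _ = @tuple_coord n j); first exact: polyfun_gen.
    by apply/funext => y; rewrite /tuple_coord /= tnthS.
  exact: (polyfun_cst _ x).
- by apply/eqP => fx; apply: qx; rewrite -[LHS](congr1 (@^~ x) qE).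
Qed.

End PolynomialFunctions.
(** * Determinants attached to a matrix *)

Section Invariants.
Context {F : comNzRingType} {n : nat}.
Implicit Types H : 'M[F]_n.

(* The trace of the [m]-th power of the commutator map X |-> H X - X H. *)
Definition ad_trace H m : F :=
  \sum_(i < m.+1) ((-1) ^+ i * \tr (H ^+ (m - i)) * \tr (H ^+ i)) *+ 'C(m, i).

(** For [n > 0] the size is the largest possible number of distinct differences of [n] numbers:
    [n * n - n] off the diagonal, and 0. *)
Definition ad_hankel H : 'M[F]_((n * n - n).+1) :=
  \matrix_(a, b) ad_trace H (a + b).

Definition diag_powers H : 'M[F]_n := \matrix_(j, m) (H ^+ m) j j.

Definition krylov H (j0 : 'I_n) : 'M[F]_n := \matrix_(i, m) (H ^+ m) i j0.

Lemma ad_traceE H (l : 'I_n -> F) m :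
  (forall m, \tr (H ^+ m) = \sum_k l k ^+ m) ->
  ad_trace H m = \sum_i \sum_j (l i - l j) ^+ m.
Proof.
move=> trH; rewrite /ad_trace.
under eq_bigr => i _ do
  rewrite !trH -mulrA big_distrlr /= mulr_sumr -sumrMnl.
rewrite exchange_big /=; apply: eq_bigr => i _.
under eq_bigr => j _ do rewrite mulr_sumr -sumrMnl.
rewrite exchange_big /=; apply: eq_bigr => j _.
by rewrite exprBn; apply: eq_bigr => k _; rewrite mulrA.
Qed.

End Invariants.

(** The Hankel matrix is W^T W for W the Vandermonde matrix of all differences [l x - l y]. Since
    [rVpoly v] has the entries of [v] as coefficients, W v^T lists its values at the differences. *)
Lemma row_mul_ad_hankel (F : comNzRingType) n (H : 'M[F]_n) (l : 'I_n -> F)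
    (v : 'rV_((n * n - n).+1)) c :
  (forall m, \tr (H ^+ m) = \sum_k l k ^+ m) ->
  (v *m ad_hankel H) 0 c =
  \sum_x \sum_y (l x - l y) ^+ c * (rVpoly v).[l x - l y].
Proof.
move=> trH; rewrite mxE.
under eq_bigr => k _ do rewrite !mxE (ad_traceE _ trH) mulr_sumr.
rewrite exchange_big; apply: eq_bigr => x _.
under eq_bigr => k _ do rewrite mulr_sumr.
rewrite exchange_big; apply: eq_bigr => y _ /=.
rewrite (horner_coef_wide _ (size_poly _ _)) mulr_sumr.
by apply: eq_bigr => k _; rewrite coef_rVpoly_ord addnC exprD mulrCA.
Qed.

(** The pair (a, b) may lie on the diagonal, so [l] is in particular injective. *)
Definition nonresonant (F : zmodType) n (l : 'I_n -> F) :=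
  forall i j a b, i != j -> l i - l j = l a - l b -> (a, b) = (i, j).

Definition offdiag n : {set 'I_n * 'I_n} := [set p | p.1 != p.2].

Lemma card_offdiag n : #|offdiag n| = (n * n - n)%N.
Proof.
have -> : offdiag n = ~: [set (i, i) | i : 'I_n].
  apply/setP => -[i j]; rewrite !inE /=; congr (~~ _); apply/eqP/imsetP.
    by move=> ->; exists j.
  by case=> k _ [-> ->].
rewrite cardsCs finset.setCK card_imset ?card_prod ?card_ord//.
by move=> i j [].
Qed.

(* The differences are the roots of a nonzero polynomial of degree less than
   the size of the Hankel matrix as soon as two of them coincide. *)
Lemma ad_hankel_nonresonant (F : fieldType) n (H : 'M[F]_n) (l : 'I_n -> F) :
  (forall m, \tr (H ^+ m) = \sum_k l k ^+ m) ->
  \det (ad_hankel H) != 0 -> nonresonant l.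
Proof.
move=> trH detH i j a b neq_ij eq_l; apply/eqP; apply: contraNT detH => neq_p.
pose D := offdiag n :\ (i, j).
pose p : {poly F} := 'X * \prod_(q in D) ('X - (l q.1 - l q.2)%:P).
have ijD : (i, j) \in offdiag n by rewrite inE.
have cD : (#|D|.+1 = n * n - n)%N.
  by rewrite -card_offdiag [RHS](cardsD1 (i, j)) ijD.
have sp : (size p <= (n * n - n).+1)%N.
  rewrite /p mulrC size_mulX ?monic_neq0 ?monic_prod_XsubC//.
  by rewrite -big_enum size_prod_XsubC -cardE -cD.
have p0 : p != 0.
  by rewrite mulf_neq0 ?polyX_eq0// monic_neq0 ?monic_prod_XsubC.
have rD q : q \in D -> p.[l q.1 - l q.2] = 0.
  move=> qD; rewrite hornerM horner_prod (bigD1 q)//= hornerXsubC subrr.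
  by rewrite mul0r mulr0.
have rp x y : p.[l x - l y] = 0.
  have [->|neq_xy] := eqVneq x y; first by rewrite subrr hornerM hornerX mul0r.
  have [[-> ->]|neq] := eqVneq (x, y) (i, j); last first.
    by apply: (rD (x, y)); rewrite !inE /= neq.
  rewrite eq_l; have [->|neq_ab] := eqVneq a b.
    by rewrite subrr hornerM hornerX mul0r.
  by apply: (rD (a, b)); rewrite !inE /= neq_p.
apply/det0P; exists (poly_rV p).
  by apply: contra p0 => /eqP e; rewrite -(poly_rV_K sp) e linear0.
apply/rowP => c; rewrite (row_mul_ad_hankel _ _ trH) poly_rV_K// !mxE.
by rewrite big1// => x _; rewrite big1// => y _; rewrite rp mulr0.
Qed.

(** Pairing a kernel row [v] with itself gives the sum of the squares of the values of [rVpoly v] at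
    the differences. In an ordered field all these values vanish, which is more roots than the
    degree allows. *)
Lemma ad_hankel_neq0 (F : realFieldType) n (H : 'M[F]_n) (l : 'I_n -> F) :
  (0 < n)%N -> (forall m, \tr (H ^+ m) = \sum_k l k ^+ m) ->
  nonresonant l -> \det (ad_hankel H) != 0.
Proof.
move=> n0 trH nr; apply/negP => /det0P[v v0 vH].
pose p := rVpoly v.
have sp : (size p <= (n * n - n).+1)%N by exact: size_poly.
have p0 : p != 0 by apply: contra v0 => /eqP e; rewrite -(rVpolyK v) -/p e linear0.
have rp x y : p.[l x - l y] = 0.
  have ge0 x' : 0 <= \sum_y' p.[l x' - l y'] ^+ 2.
    by apply: sumr_ge0 => y' _; exact: sqr_ge0.
  apply/eqP; rewrite -sqrf_eq0.
  suff /eqP : \sum_x \sum_y p.[l x - l y] ^+ 2 = 0.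
    rewrite psumr_eq0 ?ge0// => /allP/(_ x); rewrite mem_index_enum => /(_ isT).
    rewrite psumr_eq0; last by move=> y' _; exact: sqr_ge0.
    by move=> /allP/(_ y); rewrite mem_index_enum => /(_ isT).
  transitivity (\sum_c (v *m ad_hankel H) 0 c * v 0 c).
    under [RHS]eq_bigr => c _ do rewrite (row_mul_ad_hankel _ _ trH) mulr_suml.
    rewrite [RHS]exchange_big; apply: eq_bigr => x' _ /=.
    under [RHS]eq_bigr => c _ do rewrite mulr_suml.
    rewrite [RHS]exchange_big; apply: eq_bigr => y' _ /=.
    rewrite expr2 {1}(horner_coef_wide _ sp) mulr_suml.
    by apply: eq_bigr => c _; rewrite coef_rVpoly_ord [RHS]mulrC mulrA.
  by rewrite vH big1// => c _; rewrite mxE mul0r.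
pose rs := 0 :: [seq l q.1 - l q.2 | q in offdiag n].
have srs : size rs = (n * n - n).+1 by rewrite /= size_map -cardE card_offdiag.
have : (size rs < size p)%N.
  apply: max_poly_roots => //.
    apply/andP; split; last by apply/allP => _ /mapP[q _ ->]; apply/eqP/rp.
    by apply/eqP; rewrite -[X in _.[X]](subrr (l (Ordinal n0))) rp.
  rewrite /= map_inj_in_uniq ?enum_uniq ?andbT.
    apply/negP => /mapP[q]; rewrite mem_enum inE => neq_q /esym E.
    have := nr _ _ q.2 q.2 neq_q; rewrite subrr => /(_ E)[e1].
    by rewrite -e1 eqxx in neq_q.
  move=> [x1 x2] [y1 y2]; rewrite !mem_enum !inE /= => neq_x _ /(nr _ _ _ _ neq_x).
  by move=> [-> ->].
by rewrite srs ltnNge sp.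
Qed.

(** Powers of two form a Sidon set, hence have distinct differences. With both pairs ordered, the
    cases with a zero exponent are settled directly; otherwise both sides are halved. *)
Lemma pow2_sidon (a b c d : nat) :
  (2 ^ a + 2 ^ b = 2 ^ c + 2 ^ d)%N -> (a = c /\ b = d) \/ (a = d /\ b = c).
Proof.
wlog ab : a b / (a <= b)%N => [W|].
  have [/W //|/ltnW /W h] := leqP a b.
  by rewrite addnC => /h [[-> ->]|[-> ->]]; auto.
wlog cd : c d / (c <= d)%N => [W|].
  have [/W //|/ltnW /W h] := leqP c d.
  by rewrite [(2 ^ c + _)%N]addnC => /h [[-> ->]|[-> ->]]; auto.
have e2 k : (2 ^ k.+1 = (2 ^ k).*2)%N by rewrite expnS mul2n.
have p2 k : (0 < 2 ^ k)%N by rewrite expn_gt0.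
elim: a b c d ab cd => [|a IHa] [|b] [|c] [|d] //= ab cd; rewrite ?e2 ?expn0 => E.
- by left.
- by have := p2 d; lia.
- by have := p2 c; lia.
- by have := p2 b; lia.
- by left; split=> //; apply: (@expnI 2) => //; rewrite !e2; lia.
- by lia.
- by have := p2 a; have := p2 b; lia.
- by lia.
- have [] : (a = c /\ b = d) \/ (a = d /\ b = c); last by lia.
    by apply: IHa; lia.
  by lia.
Qed.

Lemma nonresonant_pow2 (F : numDomainType) n :
  nonresonant (fun i : 'I_n => (2 ^ i)%:R : F).
Proof.
move=> i j a b neq_ij /eqP; rewrite subr_eq addrAC eq_sym subr_eq -!natrD eqr_nat.
move=> /eqP/pow2_sidon; case=> -[/val_inj e1 /val_inj e2].
  by rewrite e1 e2.
by move: neq_ij; rewrite ?e1 ?e2 eqxx.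
Qed.

(** * Rescaled Hamiltonians and their limits *)

Section Weighted.
Context {F : realFieldType} {n : nat} (G : 'M[F]_n).

(** Equal to (- eps)^(1 + b - a) when |a - b| <= 1, the factor produced by the conjugation below;
    spelled out by cases, it makes sense at [eps = 0]. The sign of [- eps] absorbs that of [- G]. *)
Definition weight (eps : F) (a b : nat) : F :=
  if a == b.+1 then 1 else if a == b then - eps else if b == a.+1 then eps ^+ 2
  else 0.

(* [weighted d h eps] is [eps] times the conjugate of [diag (d / eps) - G] by
   the diagonal matrix with entries [(- eps) ^ h i], so that at [eps = 0] only
   the edges along which [h] increases by one survive. *)
Definition weighted (d : 'rV[F]_n) (h : 'I_n -> nat) (eps : F) : 'M[F]_n :=
  diag_mx d + \matrix_(i, k) (weight eps (h i) (h k) * G i k).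

Definition hamiltonian (p : 'rV[F]_n) : 'M[F]_n := diag_mx p - G.

Definition unit_steps (h : 'I_n -> nat) :=
  forall i k, G i k != 0 -> (h i <= (h k).+1)%N /\ (h k <= (h i).+1)%N.

Let E (h : 'I_n -> nat) eps : 'M[F]_n := diag_mx (\row_i (- eps) ^+ h i).

Lemma weighted_conj d h eps : unit_steps h -> eps != 0 ->
  E h eps *m weighted d h eps =
  (eps *: hamiltonian (eps^-1 *: d)) *m E h eps.
Proof.
move=> hL e0; apply/matrixP => i k.
rewrite mul_diag_mx mul_mx_diag !mxE.
have -> : eps * ((eps^-1 * d 0 i) *+ (i == k) - G i k) =
    d 0 i *+ (i == k) - eps * G i k.
  by rewrite mulrBr -mulrnAr mulrA divff// mul1r.
rewrite mulrDr mulrBl; congr (_ + _).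
  by case: eqVneq => [->|_]; rewrite ?mulr1n ?mulr0n ?mul0r ?mulr0// mulrC.
have [->|/hL[hik hki]] := eqVneq (G i k) 0; first by rewrite !(mulr0, mul0r) oppr0.
rewrite /weight; case: eqP => [->|nik]; first by rewrite exprS;
  move: (_ ^+ h k) => x; ring.
case: eqP => [->|nik']; first by rewrite mulNr mulrN mulrC.
have -> : h k = (h i).+1 by lia.
by rewrite eqxx (exprS (- eps)); move: (_ ^+ h i) => x; ring.
Qed.

Lemma weighted_exp d h eps m : unit_steps h -> eps != 0 ->
  E h eps *m weighted d h eps ^+ m =
  eps ^+ m *: hamiltonian (eps^-1 *: d) ^+ m *m E h eps.
Proof.
move=> hL e0; elim: m => [|m IHm].
  by rewrite !expr0 scale1r [_ *m 1]mulmx1 [1 *m _]mul1mx.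
rewrite exprS [weighted d h eps * _]/(_ *m _) mulmxA weighted_conj//.
rewrite -mulmxA IHm mulmxA; congr (_ *m _).
by rewrite -scalemxAl -scalemxAr scalerA -exprS [in RHS](exprS (hamiltonian _)).
Qed.

Lemma weighted0_conj d eps m : eps != 0 ->
  weighted d (fun=> 0) eps ^+ m = eps ^+ m *: hamiltonian (eps^-1 *: d) ^+ m.
Proof.
move=> e0; have := @weighted_exp d (fun=> 0) eps m _ e0.
rewrite /E (_ : \row__ _ = const_mx 1); last by apply/rowP => i; rewrite !mxE expr0.
rewrite diag_const_mx mul1mx mulmx1; apply.
by move=> i k.
Qed.

Lemma weighted0_0 d : weighted d (fun=> 0) 0 = diag_mx d.
Proof.
apply/matrixP => i k; rewrite !mxE /weight /= oppr0 mul0r addr0.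
by [].
Qed.

Lemma diag_exp (d : 'rV[F]_n) m : diag_mx d ^+ m = diag_mx (\row_i d 0 i ^+ m).
Proof.
elim: m => [|m IHm].
  by rewrite expr0; apply/matrixP => i j; rewrite !mxE expr0.
rewrite exprS -mulmxE IHm; apply/matrixP => i j.
by rewrite mul_diag_mx !mxE exprS mulrnAr.
Qed.

End Weighted.

(* If [b] is the largest [d k] on the support of [w], then [w M - b w] has smaller
   support and satisfies the same hypothesis, so it vanishes: [w] is a left
   eigenvector, and positivity propagates from its top entry down to [j0]. *)
Lemma triangular_observable (F : realFieldType) n (M L : 'M[F]_n)
    (d : 'I_n -> nat) (j0 : 'I_n) (w : 'rV_n) :
  injective d -> (forall k m, 0 <= L k m) ->
  (forall k m, L k m != 0 -> (d m < d k)%N) ->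
  (forall k, k != j0 -> exists m, L k m != 0) ->
  M = diag_mx (\row_i (d i)%:R) + L ->
  (forall m, (w *m M ^+ m) 0 j0 = 0) -> w = 0.
Proof.
move=> d_inj L0 Ld Lpath ME.
have [b] : exists b, forall k, w 0 k != 0 -> (d k < b)%N.
  exists (\max_k d k).+1 => k _; rewrite ltnS.
  exact: (leq_bigmax_cond (F := d)).
have wM (v : 'rV[F]_n) m :
    (v *m M) 0 m = v 0 m * (d m)%:R + \sum_k v 0 k * L k m.
  by rewrite ME mulmxDr mul_mx_diag !mxE.
elim: b w => [|b IHb] w wb w_obs.
  by apply/rowP => k; rewrite mxE; apply/eqP; apply: contraT => /wb.
have eigen : w *m M - b%:R *: w = 0.
  apply: IHb => [m|m]; last first.
    rewrite mulmxBl -scalemxAl -mulmxA mulmxE -exprS mxE w_obs mxE.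
    by rewrite mxE w_obs mulr0 subr0.
  rewrite mxE wM !mxE; apply: contraR; rewrite -leqNgt => bm.
  rewrite big1 => [|k _]; last first.
    have [->|/wb kb] := eqVneq (w 0 k) 0; first by rewrite mul0r.
    have [->|/Ld mk] := eqVneq (L k m) 0; first by rewrite mulr0.
    by have := leq_trans mk kb; lia.
  have [->|/wb mb] := eqVneq (w 0 m) 0; first by rewrite mul0r mulr0 addr0 subr0.
  have -> : d m = b by lia.
  by rewrite addr0 mulrC subrr.
have eigenE m : w 0 m * (b%:R - (d m)%:R) = \sum_k w 0 k * L k m.
  have := congr1 (fun v : 'rV[F]_n => v 0 m) eigen; rewrite mxE wM !mxE => E.
  by apply/eqP; rewrite mulrBr -subr_eq0 -oppr_eq0 -[X in _ == X]E; apply/eqP; ring.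
have [i /andP[/eqP di wi]|no_top] :=
  pickP (fun i => (d i == b) && (w 0 i != 0)); last first.
  apply: IHb => // k wk; have := wb k wk; rewrite ltnS leq_eqVlt => /orP[/eqP dk|//].
  by have := no_top k; rewrite dk eqxx wk.
pose u m := w 0 m / w 0 i.
have uE m : u m * (b%:R - (d m)%:R) = \sum_k u k * L k m.
  rewrite /u mulrAC eigenE mulr_suml; apply: eq_bigr => k _; ring.
have u_top m : (b <= d m)%N -> u m = (m == i)%:R.
  move=> bm; rewrite /u; case: eqVneq => [->|neq_mi]; first by rewrite divff.
  have [->|/wb mb] := eqVneq (w 0 m) 0; first by rewrite mul0r.
  by move: neq_mi; rewrite -(inj_eq d_inj) di; lia.
(* Induction downwards from level [b]: below it, [uE] expresses a positive multiple of [u m] through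
   entries [u k] with [d k > d m]. *)
have u_ge0 m : 0 <= u m.
  have [c] := ubnP (b - d m); elim: c m => // c IHc m.
  have [bm _|mb mc] := leqP b (d m); first by rewrite u_top.
  have bdm : 0 < b%:R - (d m)%:R :> F by rewrite subr_gt0 ltr_nat.
  rewrite -(pmulr_lge0 _ bdm) uE; apply: sumr_ge0 => k _.
  have [->|/Ld mk] := eqVneq (L k m) 0; first by rewrite mulr0.
  by apply: mulr_ge0 => //; apply: IHc; lia.
have u_gt0 k : 0 < u k -> 0 < u j0.
  have [c] := ubnP (d k); elim: c k => // c IHc k kc uk.
  have [<-//|/Lpath[m Lkm]] := eqVneq k j0.
  have mk := Ld _ _ Lkm.
  have mb : (d m < b)%N.
    apply: (leq_trans mk); have : w 0 k != 0.
      by apply: contraTneq uk => wk; rewrite /u wk mul0r ltxx.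
    by move/wb.
  apply: (IHc m); first by lia.
  have bdm : 0 < b%:R - (d m)%:R :> F by rewrite subr_gt0 ltr_nat.
  rewrite -(pmulr_lgt0 _ bdm) uE (bigD1 k)//= ltr_wpDr//.
    by apply: sumr_ge0 => k' _; exact: mulr_ge0.
  by rewrite mulr_gt0// lt0r Lkm L0.
have := w_obs 0%N; rewrite expr0 mulmx1 => wj0.
have : 0 < u j0 by apply: (u_gt0 i); rewrite /u divff.
by rewrite /u wj0 mul0r ltxx.
Qed.

(** By Cayley-Hamilton: modulo the characteristic polynomial, ['X^m] becomes a polynomial of degree
    less than [n], and the powers of [M] below [n] supply the columns of the Krylov matrix. *)
Lemma krylov_annihilator (F : fieldType) n (M : 'M[F]_n) j0 (w : 'rV_n) :
  w *m krylov M j0 = 0 -> forall m, (w *m M ^+ m) 0 j0 = 0.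
Proof.
case: n M j0 w => [_ []//|n] M j0 w wK m.
have wr (r : {poly F}) : (size r <= n.+1)%N -> (w *m horner_mx M r) 0 j0 = 0.
  move=> sr; rewrite -(poly_rV_K sr) horner_rVpoly (mulmx_sum_row (poly_rV r)).
  rewrite linear_sum.
  rewrite mulmx_sumr summxE big1// => i _.
  rewrite linearZ /= rowK mxvecK -scalemxAr mxE.
  suff -> : (w *m M ^+ i) 0 j0 = 0 by rewrite mulr0.
  transitivity ((w *m krylov M j0) 0 i); last by rewrite wK mxE.
  by rewrite !mxE; apply: eq_bigr => k _; rewrite mxE.
rewrite -[M in M ^+ m]horner_mx_X -rmorphXn (divp_eq 'X^m (char_poly M)).
rewrite rmorphD rmorphM /= Cayley_Hamilton mulr0 add0r wr//.
by rewrite -ltnS -(size_char_poly M) ltn_modp monic_neq0 ?char_poly_monic.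
Qed.

Section Rescaling.
Context {F : realFieldType} {n : nat} (G : 'M[F]_n) (d : 'rV[F]_n) (eps : F).
Hypothesis eps0 : eps != 0.

Let H := hamiltonian G (eps^-1 *: d).

Let det_powers k : \det (diag_mx (\row_(m < k) eps ^+ m)) != 0.
Proof.
by rewrite det_diag; apply/prodf_neq0 => i _; rewrite mxE expf_neq0.
Qed.

(** Since [h j0 = 0], the conjugating matrix fixes the basis vector at [j0], so the two Krylov
    matrices differ by invertible diagonal factors. *)
Lemma det_krylov_weighted h j0 : unit_steps G h -> h j0 = 0 ->
  \det (krylov (weighted G d h eps) j0) != 0 -> \det (krylov H j0) != 0.
Proof.
move=> hL hj0; apply: contra => /eqP detH.
pose E : 'M[F]_n := diag_mx (\row_i (- eps) ^+ h i).
have detE : \det E != 0.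
  by rewrite det_diag; apply/prodf_neq0 => i _; rewrite mxE expf_neq0// oppr_eq0.
have EK : E *m krylov (weighted G d h eps) j0 =
    krylov H j0 *m diag_mx (\row_m eps ^+ m).
  apply/matrixP => i m; rewrite mul_mx_diag mul_diag_mx !mxE.
  have := congr1 (fun A : 'M[F]_n => A i j0) (weighted_exp d m hL eps0).
  by rewrite mul_mx_diag mul_diag_mx !mxE hj0 expr0 mulr1 [RHS]mulrC.
have := congr1 determinant EK; rewrite !det_mulmx detH mul0r => /eqP.
by rewrite mulf_eq0 (negbTE detE).
Qed.

Lemma det_diag_powers_weighted :
  \det (diag_powers (weighted G d (fun=> 0) eps)) != 0 ->
  \det (diag_powers H) != 0.
Proof.
rewrite (_ : diag_powers _ = diag_powers H *m diag_mx (\row_m eps ^+ m)).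
  by rewrite det_mulmx mulf_eq0 negb_or => /andP[].
apply/matrixP => i m; rewrite mul_mx_diag !mxE weighted0_conj// mxE.
exact: mulrC.
Qed.

(** [ad_trace H m] is homogeneous of degree [m] in [H], so scaling [H] by [eps] multiplies the entry
    (a, b) by eps^a eps^b. *)
Lemma det_ad_hankel_weighted :
  \det (ad_hankel (weighted G d (fun=> 0) eps)) != 0 ->
  \det (ad_hankel H) != 0.
Proof.
pose D : 'M[F]_((n * n - n).+1) := diag_mx (\row_m eps ^+ m).
rewrite (_ : ad_hankel _ = D *m ad_hankel H *m D).
  by rewrite !det_mulmx !mulf_eq0 !negb_or => /andP[/andP[]].
apply/matrixP => i m; rewrite mul_mx_diag mul_diag_mx !mxE.
rewrite mulrAC -exprD /ad_trace mulr_sumr; apply: eq_bigr => k _.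
have km : (k <= i + m)%N by rewrite -ltnS.
have -> : eps ^+ (i + m) = eps ^+ (i + m - k) * eps ^+ k by rewrite -exprD subnK.
rewrite !weighted0_conj// !mxtraceZ mulrnAr -/H; congr (_ *+ _).
have aux (s a b x y : F) : s * (a * x) * (b * y) = a * b * (s * x * y) by ring.
exact: aux.
Qed.

End Rescaling.

Section Unperturbed.
Context {F : realFieldType} {n : nat}.

Lemma det_diag_powers_diag (d : 'rV[F]_n) :
  injective (d 0) -> \det (diag_powers (diag_mx d)) != 0.
Proof.
move=> d_inj; rewrite -det_tr.
rewrite (_ : trmx _ = Vandermonde n d).
  rewrite det_Vandermonde; apply/prodf_neq0 => i _; apply/prodf_neq0 => j ij.
  by rewrite subr_eq0 (inj_eq d_inj) -(inj_eq val_inj) gtn_eqF.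
by apply/matrixP => i j; rewrite !mxE diag_exp !mxE eqxx.
Qed.

Lemma det_ad_hankel_diag (d : 'rV[F]_n) :
  (0 < n)%N -> nonresonant (d 0) -> \det (ad_hankel (diag_mx d)) != 0.
Proof.
move=> n0 nr; apply: (ad_hankel_neq0 n0 _ nr) => m.
by rewrite diag_exp mxtrace_diag; apply: eq_bigr => i _; rewrite mxE.
Qed.

(** The diagonal [n * h i + i] orders the vertices by [h], with ties broken by the index. It is
    injective by reduction modulo [n], and it drops whenever [h] drops because indices are below
    [n]; so the limit matrix is triangular for this order. *)
Lemma det_krylov_weighted0 (G : 'M[F]_n) (h : 'I_n -> nat) j0 :
  (forall i k, 0 <= G i k) ->
  (forall k, k != j0 -> exists m, G k m != 0 /\ h k = (h m).+1) ->
  \det (krylov (weighted G (\row_i (n * h i + i)%:R) h 0) j0) != 0.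
Proof.
move=> G0 hpath; apply/negP => /det0P[w /eqP w0 wK]; apply: w0.
apply: (@triangular_observable _ _ (weighted G (\row_i (n * h i + i)%:R) h 0)
  (\matrix_(i, k) ((h i == (h k).+1)%:R * G i k)) (fun i => n * h i + i)%N j0).
- move=> i k E; apply: val_inj; have := congr1 (fun x => x %% n)%N E.
  by rewrite /= ![(n * _)%N]mulnC !modnMDl !modn_small.
- by move=> k m; rewrite mxE mulr_ge0// ler0n.
- move=> k m; rewrite mxE; case: (h k =P _) => [->|_]; last by rewrite mul0r eqxx.
  by move=> _; have := ltn_ord m; lia.
- move=> k /hpath[m [Gkm hk]]; exists m.
  by rewrite mxE hk eqxx mul1r.
- rewrite /weighted; congr (_ + _); apply/matrixP => i k; rewrite !mxE /weight.
  by case: eqP => _; rewrite ?oppr0 ?expr0n //=; do 2?case: ifP.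
- exact: krylov_annihilator wK.
Qed.

End Unperturbed.
(** * Nonvanishing for almost every potential *)

Section Genericity.
Context {R : realType}.

Section Polynomiality.
Context {I T : Type} (g : I -> T -> R) {n : nat} (M : T -> 'M[R]_n).
Hypothesis gM : polymx g M.

Lemma polymx_krylov j0 : polymx g (fun x => krylov (M x) j0).
Proof.
move=> i m; rewrite [X in polyfun _ X](_ : _ = fun x => (M x ^+ m) i j0).
  exact: polymx_exp.
by apply/funext => x; rewrite mxE.
Qed.

Lemma polymx_diag_powers : polymx g (fun x => diag_powers (M x)).
Proof.
move=> i m; rewrite [X in polyfun _ X](_ : _ = fun x => (M x ^+ m) i i).
  exact: polymx_exp.
by apply/funext => x; rewrite mxE.
Qed.

Lemma polymx_ad_hankel : polymx g (fun x => ad_hankel (M x)).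
Proof.
move=> a b.
rewrite [X in polyfun _ X](_ : _ = fun x => ad_trace (M x) (a + b)); last first.
  by apply/funext => x; rewrite mxE.
apply: polyfun_sum => i.
rewrite [X in polyfun _ X](_ : _ = fun x => 'C(a + b, i)%:R * ((-1) ^+ i *
    \tr (M x ^+ (a + b - i)) * \tr (M x ^+ i))); last first.
  by apply/funext => x; rewrite mulr_natl.
apply: polyfunM; first exact: polyfun_cst.
apply: polyfunM; last exact/polyfun_tr/polymx_exp.
apply: polyfunM; first exact: polyfun_cst.
exact/polyfun_tr/polymx_exp.
Qed.

End Polynomiality.

(** Carries nonvanishing from the limit [eps = 0] to some [eps != 0], where the rescaling can be
    undone. The product of the polynomial with ['X] is nonzero, hence does not vanish at all of
    sufficiently many natural numbers. *)
Lemma polyfun_neq0_near0 (f : R -> R) :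
  polyfun (fun (_ : unit) x => x) f -> f 0 != 0 -> exists2 x, x != 0 & f x != 0.
Proof.
move=> /polyfun_horner[p ->] p0.
have pX0 : p * 'X != 0.
  by rewrite mulf_neq0 ?polyX_eq0//; apply: contra p0 => /eqP ->; rewrite horner0.
apply: contrapT => nx; pose rs := [seq i%:R : R | i <- iota 0 (size (p * 'X))].
have : (size rs < size (p * 'X)%R)%N.
  apply: max_poly_roots => //; last by rewrite map_inj_uniq ?iota_uniq//; exact: mulrIn.
  apply/allP => _ /mapP[i _ ->]; rewrite rootE hornerM hornerX mulf_eq0.
  apply/orP; have [->|i0] := eqVneq (i%:R : R) 0; [by right|left].
  by apply/negPn/negP => pi; apply: nx; exists i%:R.
by rewrite size_map size_iota ltnn.
Qed.

Lemma polymx_weighted n (G : 'M[R]_n) d h :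
  polymx (fun (_ : unit) x => x) (weighted G d h).
Proof.
move=> i k; rewrite [X in polyfun _ X](_ : _ = fun x =>
    diag_mx d i k + weight x (h i) (h k) * G i k); last first.
  by apply/funext => x; rewrite !mxE.
apply: polyfunD; first exact: polyfun_cst.
apply: polyfunM; last exact: polyfun_cst.
rewrite /weight; case: (h i == _.+1); first exact: polyfun_cst.
case: (h i == h k).
  rewrite [X in polyfun _ X](_ : _ = fun x => -1 * x); last first.
    by apply/funext => x; rewrite mulN1r.
  by apply: polyfunM; [exact: polyfun_cst|exact: (polyfun_gen _ tt)].
case: (h k == _.+1); last exact: polyfun_cst.
by apply: polyfunM; exact: (polyfun_gen _ tt).
Qed.

Lemma exists_krylov n (G : 'M[R]_n) (h : 'I_n -> nat) j0 :
  (forall i k, 0 <= G i k) -> unit_steps G h -> h j0 = 0 ->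
  (forall k, k != j0 -> exists m, G k m != 0 /\ h k = (h m).+1) ->
  exists p, \det (krylov (hamiltonian G p) j0) != 0.
Proof.
move=> G0 hL hj0 hpath; have := det_krylov_weighted0 G0 hpath.
set d := (X in weighted G X) => /(@polyfun_neq0_near0
  (fun x => \det (krylov (weighted G d h x) j0)))[].
  by apply: polyfun_det; apply: polymx_krylov; exact: polymx_weighted.
move=> x x0 Kx; exists (x^-1 *: d).
exact: (det_krylov_weighted x0 hL hj0).
Qed.

Lemma exists_diag_powers n (G : 'M[R]_n) :
  exists p, \det (diag_powers (hamiltonian G p)) != 0.
Proof.
pose d : 'rV[R]_n := \row_i i%:R.
have d_inj : injective (d 0).
  by move=> i j /eqP; rewrite !mxE eqr_nat => /eqP/val_inj.
have [] := @polyfun_neq0_near0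
  (fun x => \det (diag_powers (weighted G d (fun=> 0%N) x))).
- by apply: polyfun_det; apply: polymx_diag_powers; exact: polymx_weighted.
- by rewrite weighted0_0; exact: det_diag_powers_diag.
- by move=> x x0 Kx; exists (x^-1 *: d); exact: det_diag_powers_weighted Kx.
Qed.

Lemma exists_ad_hankel n (G : 'M[R]_n) : (0 < n)%N ->
  exists p, \det (ad_hankel (hamiltonian G p)) != 0.
Proof.
move=> n0; pose d : 'rV[R]_n := \row_i (2 ^ i)%:R.
have d_nr : nonresonant (d 0).
  by move=> i j a b ij; rewrite !mxE; exact: nonresonant_pow2.
have [] := @polyfun_neq0_near0
  (fun x => \det (ad_hankel (weighted G d (fun=> 0%N) x))).
- by apply: polyfun_det; apply: polymx_ad_hankel; exact: polymx_weighted.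
- by rewrite weighted0_0; exact: det_ad_hankel_diag.
- by move=> x x0 Kx; exists (x^-1 *: d); exact: det_ad_hankel_weighted Kx.
Qed.

End Genericity.

(** [h] is the least length of a path from [x0]; the last claim takes the penultimate vertex of a
    shortest path. *)
Lemma graph_distance (V : finType) (e : rel V) x0 :
  (forall y, connect e x0 y) -> exists h : V -> nat,
  [/\ h x0 = 0%N, forall x y, e x y -> (h y <= (h x).+1)%N &
      forall y, y != x0 -> exists x, e x y /\ h y = (h x).+1].
Proof.
move=> conn.
pose P y k := [exists p : k.-tuple V, path e x0 p && (last x0 p == y)].
have PI p : path e x0 p -> P (last x0 p) (size p).
  by move=> ep; apply/existsP; exists (in_tuple p); rewrite ep eqxx.
have exP y : exists k, P y k.
  by have /connectP[p ep ->] := conn y; exists (size p); exact: PI.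
pose h y := ex_minn (exP y).
have h_min p : path e x0 p -> (h (last x0 p) <= size p)%N.
  by move=> /PI Pp; rewrite /h; case: ex_minnP => k _; exact.
have h_path y : exists p, [/\ path e x0 p, last x0 p = y & size p = h y].
  rewrite /h; case: ex_minnP => k /existsP[p /andP[ep /eqP lp]] _.
  by exists p; rewrite ep lp size_tuple.
have h_step x y : e x y -> (h y <= (h x).+1)%N.
  have [p [ep lp <-]] := h_path x => exy; rewrite -(size_rcons p y).
  by rewrite -{1}(last_rcons x0 p y); apply: h_min; rewrite rcons_path ep lp.
exists h; split=> // [|y yx0].
  by apply/eqP; rewrite -leqn0; exact: (h_min [::]).
have [p [+ + sp]] := h_path y; rewrite -sp; case: (lastP p) sp => [|p' z] sp.
  by move=> _ /= xy; rewrite xy eqxx in yx0.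
rewrite rcons_path last_rcons => /andP[ep' ez] zy; rewrite zy in ez.
exists (last x0 p'); split=> //; rewrite size_rcons; congr _.+1.
apply/eqP; rewrite eqn_leq h_min// andbT -ltnS -(size_rcons p' z) sp.
exact: h_step.
Qed.

(** * The Schrödinger operator as a real matrix *)

Section SchrodingerMatrix.
Context {R : realType} {V : finType} (e : rel V).

Definition adjacency : 'M[R]_#|V| :=
  \matrix_(i, k) (e (enum_val i) (enum_val k))%:R.

(** The Laplacian is the degree matrix minus the adjacency matrix; the degrees go to the diagonal,
    where they only translate the potential. *)
Definition schrodinger_mx (q : #|V|.-tuple (measurableTypeR R)) : 'M[R]_#|V| :=
  hamiltonian adjacency (\row_i (tnth q i + \sum_k adjacency i k)).

Lemma polymx_schrodinger : polymx (@tuple_coord R #|V|) schrodinger_mx.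
Proof.
move=> i k; rewrite [X in polyfun _ X](_ : _ = fun q => (i == k)%:R *
    (tuple_coord i q + \sum_k adjacency i k) + - adjacency i k); last first.
  by apply/funext => q; rewrite !mxE mulr_natl.
apply: polyfunD; last exact: polyfun_cst.
apply: polyfunM; first exact: polyfun_cst.
by apply: polyfunD; [exact: polyfun_gen|exact: polyfun_cst].
Qed.

Lemma ae_schrodinger_det k (Phi : 'M[R]_#|V| -> 'M[R]_k) :
  (forall M, polymx (@tuple_coord R #|V|) M ->
    polymx (@tuple_coord R #|V|) (Phi \o M)) ->
  (exists p, \det (Phi (hamiltonian adjacency p)) != 0) ->
  {ae lebesgue_measure_tuple R #|V|,
    forall q, \det (Phi (schrodinger_mx q)) != 0}.
Proof.
move=> gPhi [p Pp].
have gdet : polyfun (@tuple_coord R #|V|) (fun q => \det (Phi (schrodinger_mx q))).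
  by apply: polyfun_det; apply: gPhi; exact: polymx_schrodinger.
exists [set q | \det (Phi (schrodinger_mx q)) = 0]; split.
- exact: measurable_polyfun_zeros gdet.
(* The witness undoes the translation by the degrees. *)
- apply: (polyfun_zeros_null
    (p := [tuple p 0 i - \sum_k adjacency i k | i < #|V|]) gdet).
  rewrite /schrodinger_mx (_ : \row_i _ = p)//.
  by apply/rowP => i; rewrite mxE tnth_mktuple subrK.
- by move=> q /= /negP; rewrite negbK => /eqP.
Qed.

Lemma adjacency_distance (j0 : 'I_#|V|) : symmetric e -> connected_graph e ->
  exists h : 'I_#|V| -> nat, [/\ h j0 = 0%N, unit_steps adjacency h &
    forall k, k != j0 -> exists m, adjacency k m != 0 /\ h k = (h m).+1].
Proof.
move=> e_sym /(_ (enum_val j0)) /graph_distance[h [h0 h1 h2]].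
exists (h \o enum_val); split=> //= [i k|k kj0].
  rewrite mxE pnatr_eq0 eqb0 negbK => ik; split; last exact: h1.
  by apply: h1; rewrite e_sym.
have [|x [exk hk]] := h2 (enum_val k).
  by rewrite (inj_eq enum_val_inj).
exists (enum_rank x); rewrite /= enum_rankK; split=> //.
by rewrite mxE enum_rankK e_sym exk oner_neq0.
Qed.

End SchrodingerMatrix.
(** * Trigonometric sums *)

Section UnitCircle.
Context {R : realType}.
Local Open Scope complex_scope.

Lemma cvg_real_complex (f : R^nat) (l : R) : f @ \oo --> l ->
  (fun n => (f n)%:C : R[i]^o) @ \oo --> (l%:C : R[i]^o).
Proof.
move=> /cvgrPdist_lt fl; apply/cvgrPdist_lt => eps eps0.
have epsE : eps = (complex.Re eps)%:C by rewrite RRe_real// gtr0_real.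
have Reps0 : 0 < complex.Re eps by rewrite -ltcR -epsE.
near=> n; rewrite -rmorphB normc_def /= expr0n addr0 sqrtr_sqr epsE ltcR.
by near: n; exact: fl.
Unshelve. all: by end_near.
Qed.

Definition cis (x : R) : R[i] := (cos x)%:C + 'i * (sin x)%:C.

Lemma exp_coeff_cis (x : R) k :
  (k`!%:R)^-1 * ('i * x%:C) ^+ k =
  (cos_coeff x k)%:C + 'i * (sin_coeff x k)%:C :> R[i].
Proof.
rewrite /cos_coeff /sin_coeff /= !rmorphM /= !fmorphV !rmorphXn /=.
rewrite !rmorph_nat rmorphN1 exprMn.
have -> : 'i ^+ k = (~~ odd k)%:R * (-1) ^+ k./2 +
    'i * ((odd k)%:R * (-1) ^+ k.-1./2) :> R[i].
  rewrite -{1}(odd_double_half k) exprD -mul2n exprM sqr_i.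
  case: k => [|k] /=; first by rewrite !mul0r mulr0 addr0 !expr0 mul1r.
  rewrite uphalf_half; case: (odd k) => /=.
    by rewrite expr0 !mul0r mulr0 addr0.
  by rewrite expr1 mul0r add0r add0n mul1r.
move: (_ ^+ k./2) (_ ^+ k.-1./2) (x%:C ^+ k) (k`!%:R^-1) => a b c d; ring.
Qed.

Lemma cvg_cis (x : R) :
  (fun n => \sum_(0 <= k < n) (k`!%:R)^-1 * ('i * x%:C) ^+ k : R[i]^o) @ \oo -->
  (cis x : R[i]^o).
Proof.
rewrite [X in X @ \oo --> _](_ : _ =
  (fun n => (series (cos_coeff x) n)%:C : R[i]^o) \+
  (fun n => ('i : R[i]) *: ((series (sin_coeff x) n)%:C : R[i]^o))).
  apply: cvgD.
    by apply: cvg_real_complex; rewrite unlock; exact: is_cvg_series_cos_coeff.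
  apply: cvgZ; first exact: cvg_cst.
  by apply: cvg_real_complex; rewrite unlock; exact: is_cvg_series_sin_coeff.
apply/funext => n; rewrite /series /= !rmorph_sum scaler_sumr -big_split /=.
by apply: eq_bigr => k _; rewrite exp_coeff_cis.
Qed.

Lemma cisE x : cis x = cos x +i* sin x.
Proof. by rewrite [RHS]complexE. Qed.

Lemma cisD x y : cis (x + y) = cis x * cis y.
Proof. by rewrite !cisE cosD sinD; simpc; rewrite [cos x * sin y + _]addrC. Qed.

Lemma cis0 : cis 0 = 1.
Proof. by rewrite cisE cos0 sin0. Qed.

Lemma cisMn x n : cis (x *+ n) = cis x ^+ n.
Proof.
by elim: n => [|n IHn]; rewrite ?mulr0n ?cis0 ?expr0// mulrS exprS cisD IHn.
Qed.

Lemma conj_cis x : (cis x)^* = cis (- x).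
Proof. by rewrite !cisE cosN sinN. Qed.

Lemma cis_eq1 x : `|x| < 1 -> cis x = 1 -> x = 0.
Proof.
move=> x1; rewrite cisE => -[cx _]; apply/normr0_eq0.
apply: cos_inj.
- by rewrite in_itv /= normr_ge0 (le_trans (ltW x1))// (le_trans _ (pi_ge2 R))// ler1n.
- by rewrite in_itv /= lexx pi_ge0.
rewrite cos0 -cx; have [x0|x0] := lerP 0 x; first by rewrite ger0_norm.
by rewrite ltr0_norm// cosN.
Qed.

(* Sampling at [s, 2s, 3s...] for a small step [s] turns the relation into one
   between powers of the distinct numbers [cis (mu k * s)], and a polynomial
   vanishing at all of them but one isolates a frequency. *)
Lemma cis_sum_eq0 (I : finType) (mu : I -> R) (c : I -> R[i]) (T : R) : 0 < T ->
  (forall t, 0 <= t <= T -> \sum_k c k * cis (mu k * t) = 0) ->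
  forall nu, \sum_(k | mu k == nu) c k = 0.
Proof.
move=> T0 sum0 nu.
(* The step [s = 1 / D] serves two purposes: the term [N.+1%:R / T] keeps the samples [s *+ m] with
   [m <= N] in [0, T], and the term [K] gives |nu - mu k| s < 1, so that [cis] separates [nu * s]
   from [mu k * s] whenever [mu k != nu]. *)
pose N := #|I|; pose K := \sum_k `|nu - mu k|.
have K0 : 0 <= K by apply: sumr_ge0.
pose D := N.+1%:R / T + K.
have D0 : 0 < D by rewrite ltr_wpDr// divr_gt0// ltr0n.
pose s := D^-1.
have s0 : 0 < s by rewrite invr_gt0.
have sN m : (m <= N)%N -> 0 <= s *+ m <= T.
  move=> mN; rewrite mulrn_wge0 ?(ltW s0)//= -mulr_natl ler_pdivrMr//.
  rewrite mulrDr mulrCA divff ?gt_eqF// mulr1 (@le_trans _ _ N.+1%:R)//.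
    by rewrite ler_nat ltnW.
  by rewrite lerDl mulr_ge0// ltW.
pose z k := cis (mu k * s).
have zP k : z k = cis (nu * s) -> mu k = nu.
  move=> zk; apply/esym/eqP; rewrite -subr_eq0; apply/eqP.
  apply: (mulIf (lt0r_neq0 s0)); rewrite mul0r; apply: cis_eq1.
    rewrite normrM (gtr0_norm s0) ltr_pdivrMr// mul1r ltr_pwDl//.
      by rewrite divr_gt0// ltr0n.
    by rewrite /K (bigD1 k)//= lerDl sumr_ge0.
  by rewrite mulrBl cisD -zk -cisD subrr cis0.
pose p := \prod_(k | mu k != nu) ('X - (z k)%:P).
have sp : (size p <= N.+1)%N.
  rewrite /p -big_filter size_prod_XsubC ltnS size_filter.
  by rewrite (leq_trans (count_size _ _))// /N cardT enumT.
have p_nu : p.[cis (nu * s)] != 0.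
  rewrite horner_prod; apply/prodf_neq0 => k; apply: contra.
  by rewrite hornerXsubC subr_eq0 => /eqP/esym/zP ->.
have p_eq k : p.[z k] = p.[cis (nu * s)] * (mu k == nu)%:R.
  rewrite /z; case: eqP => [->|/eqP k_nu]; first by rewrite mulr1.
  by rewrite mulr0 horner_prod (bigD1 k)//= hornerXsubC subrr mul0r.
have : \sum_k c k * p.[z k] = 0.
  under eq_bigr => k _ do rewrite (horner_coef_wide _ sp) mulr_sumr.
  rewrite exchange_big big1// => m _ /=.
  transitivity (p`_m * \sum_k c k * cis (mu k * (s *+ m))).
    rewrite mulr_sumr; apply: eq_bigr => k _.
    by rewrite mulrnAr cisMn mulrCA.
  by rewrite sum0 ?mulr0// sN// -ltnS.
under eq_bigr => k _ do rewrite p_eq mulrCA.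
rewrite -mulr_sumr => /eqP; rewrite mulf_eq0 (negbTE p_nu) /= => /eqP sum_nu.
rewrite -[RHS]sum_nu big_mkcond; apply: eq_bigr => k _.
by case: eqP => _; rewrite ?mulr1 ?mulr0.
Qed.

End UnitCircle.
(** * Evolution in an eigenbasis *)

(** The spectral theorem for the complexified matrix, hermitian because [M] is real and symmetric.
    The columns of [U] are orthonormal eigenvectors. All powers are covered because the determinants
    and the exponential series see only entries of powers. *)
Lemma real_symmetric_spectral (R : realType) n (M : 'M[R]_n) : trmx M = M ->
  exists (U : 'M[R[i]]_n) (l : 'I_n -> R),
  [/\ forall k k', \sum_j (U j k)^* * U j k' = (k == k')%:R,
      forall j j', \sum_k U j k * (U j' k)^* = (j == j')%:R &
      forall m i j, real_complex R ((M ^+ m) i j) =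
        \sum_k U i k * real_complex R (l k ^+ m) * (U j k)^*].
Proof.
move=> MT; pose A := map_mx (real_complex R) M.
have Aherm : A \is hermsymmx.
  apply/is_hermitianmxP; rewrite expr0 scale1r.
  apply/matrixP => i j; rewrite !mxE -[in RHS]MT mxE.
  by rewrite (CrealP _)//; apply/complex_realP; exists (M i j).
pose P := spectralmx A; pose D := spectral_diag A.
have Pu : P \is unitarymx := spectral_unitarymx A.
have PP : P *m (trmx P ^ Num.conj)%sesqui = 1%:M by exact/unitarymxP.
have PP' : (trmx P ^ Num.conj)%sesqui *m P = 1%:M by exact: mulmx1C.
have AE : A = (trmx P ^ Num.conj)%sesqui *m diag_mx D *m P.
  have /hermitian_normalmx/orthomx_spectralP := Aherm.
  by rewrite invmx_unitary.
have Dreal k : exists d : R, D 0 k = real_complex R d.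
  by apply/complex_realP; have /mxOverP := hermitian_spectral_diag_real Aherm.
have [l lE] := choice Dreal.
have AX m :
    A ^+ m = (trmx P ^ Num.conj)%sesqui *m diag_mx (\row_k D 0 k ^+ m) *m P.
  elim: m => [|m IHm].
    rewrite expr0 (_ : \row__ _ = const_mx 1) ?diag_const_mx ?mulmx1//.
    by apply/rowP => k; rewrite !mxE expr0.
  rewrite exprS IHm {1}AE -mulmxE -!mulmxA (mulmxA P) PP mul1mx.
  congr (_ *m _); rewrite mulmxA; congr (_ *m _).
  by apply/matrixP => i j; rewrite mul_diag_mx !mxE exprS mulrnAr.
exists (trmx P ^ Num.conj)%sesqui, l; split.
- move=> k k'; have := congr1 (fun X : 'M[R[i]]_n => X k k') PP; rewrite !mxE => <-.
  by apply: eq_bigr => j _; rewrite !mxE conjCK.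
- move=> j j'; have := congr1 (fun X : 'M[R[i]]_n => X j j') PP'; rewrite !mxE => <-.
  by apply: eq_bigr => k _; rewrite !mxE conjCK.
move=> m i j.
have := congr1 (fun X : 'M[R[i]]_n => X i j) (AX m).
rewrite /A -rmorphXn mxE => ->; rewrite mul_mx_diag !mxE.
by apply: eq_bigr => k _; rewrite !mxE conjCK lE rmorphXn.
Qed.
Section Evolution.
Context {R : realType} {V : finType} (e : rel V).
Variable q : #|V|.-tuple (measurableTypeR R).
Local Notation toC := (real_complex R).
Let M := schrodinger_mx e q.

Lemma sum_enum_val (F : V -> R[i]) : \sum_j F j = \sum_(i < #|V|) F (enum_val i).
Proof. by rewrite (reindex _ (onW_bij _ (enum_val_bij V))). Qed.

Lemma schrodinger_mxE (w : {ffun V -> R[i]}) (i : 'I_#|V|) :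
  schrodinger e (potential q) w (enum_val i) =
  \sum_k toC (M i k) * w (enum_val k).
Proof.
rewrite /schrodinger /laplacian !ffunE enum_valK big_mkcond sum_enum_val.
pose a k := toC (adjacency e i k).
have ME k : toC (M i k) = (toC (tnth q i) + \sum_k a k) *+ (i == k) - a k.
  by rewrite /a !mxE rmorphB rmorphMn rmorphD rmorph_sum.
under [RHS]eq_bigr => k _ do rewrite ME mulrBl.
rewrite sumrB [in RHS](bigD1 i)//= eqxx mulr1n [X in _ + X - _]big1 ?addr0; last first.
  by move=> k ki; rewrite eq_sym (negbTE ki) mulr0n mul0r.
rewrite mulrDl mulr_suml -addrA -sumrB addrC; congr (_ + _).
apply: eq_bigr => k _; rewrite /a mxE.
by case: (e _ _); rewrite ?rmorph1 ?mul1r// rmorph0 !mul0r subrr.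
Qed.

Section Eigenbasis.
Context (U : 'M[R[i]]_#|V|) (l : 'I_#|V| -> R).
Hypothesis UM : forall m i j,
  toC ((M ^+ m) i j) = \sum_k U i k * toC (l k ^+ m) * (U j k)^*.

Definition spectral_coef (u : {ffun V -> R[i]}) k :=
  \sum_j (U j k)^* * u (enum_val j).

Lemma iter_evolutionE (c : R[i]) m (u : {ffun V -> R[i]}) (i : 'I_#|V|) :
  iter m (fun w => c *: schrodinger e (potential q) w) u (enum_val i) =
  \sum_k U i k * spectral_coef u k * (c * toC (l k)) ^+ m.
Proof.
transitivity (c ^+ m * \sum_j toC ((M ^+ m) i j) * u (enum_val j)).
  elim: m i => [|m IHm] i.
    rewrite expr0 mul1r (bigD1 i)//= !mxE eqxx rmorph1 mul1r big1 ?addr0// => j ji.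
    by rewrite !mxE eq_sym (negbTE ji) rmorph0 mul0r.
  rewrite iterS ffunE -[_ *: _]/(c * _) schrodinger_mxE exprS -mulrA; congr (_ * _).
  under eq_bigr => k _ do rewrite IHm mulrCA.
  rewrite -mulr_sumr; congr (_ * _).
  under [RHS]eq_bigr => j _ do rewrite exprS mxE rmorph_sum mulr_suml.
  rewrite exchange_big; apply: eq_bigr => k _ /=; rewrite mulr_sumr.
  by apply: eq_bigr => j _; rewrite rmorphM mulrA.
rewrite mulr_sumr; under eq_bigr => j _ do rewrite UM mulr_suml mulr_sumr.
rewrite exchange_big; apply: eq_bigr => k _ /=.
rewrite /spectral_coef mulr_sumr mulr_suml; apply: eq_bigr => j _.
rewrite rmorphXn exprMn; move: (U i k) (_ ^+ m) (_ ^+ m) (u _) (_^*) => a b d f g.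
ring.
Qed.

(** Each partial sum of the exponential series is a finite combination, over the eigenvalues, of
    partial sums for [cis (- l k * t)], so the limit is taken term by term. *)
Lemma evolutionE t (u : {ffun V -> R[i]}) (i : 'I_#|V|) :
  evolution (schrodinger e (potential q)) t u (enum_val i) =
  \sum_k U i k * spectral_coef u k * cis (- l k * t).
Proof.
rewrite /evolution /operator_exp ffunE; apply: (@cvg_lim R[i]^o); first exact: norm_hausdorff.
rewrite [X in X @ \oo --> _](_ : _ = fun n => \sum_k
    (U i k * spectral_coef u k : R[i]) *: ((\sum_(0 <= m < n)
    (m`!%:R)^-1 * ((0 +i* 1)%C * toC (- l k * t)) ^+ m) : R[i]^o)); last first.
  apply/funext => n; under eq_bigr => m _ do rewrite iter_evolutionE mulr_sumr.
  rewrite exchange_big; apply: eq_bigr => k _ /=.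
  rewrite scaler_sumr; apply: eq_bigr => m _.
  transitivity (U i k * spectral_coef u k *
    (m`!%:R^-1 * ((0 +i* 1)%C * toC (- l k * t)) ^+ m)) => //.
  rewrite mulrCA; congr (_ * (_ * _ ^+ m)).
  by rewrite complexiE !rmorphM rmorphN /=; ring.
apply: cvg_big => [|k _]; first exact: add_continuous.
by apply: cvgZ; [exact: cvg_cst|exact: cvg_cis].
Qed.

End Eigenbasis.
End Evolution.

(** * Phase retrieval from the three determinants *)

Section Retrieval.
Context {R : realType} {V : finType} (e : rel V).
Variable q : #|V|.-tuple (measurableTypeR R).
Local Notation toC := (real_complex R).
Let M := schrodinger_mx e q.

Lemma trmx_schrodinger : symmetric e -> trmx M = M.
Proof.
move=> e_sym; apply/matrixP => i k; rewrite !mxE e_sym; congr (_ - _).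
by case: (eqVneq i k) => [->|]; rewrite ?eqxx// => ik; rewrite eq_sym (negbTE ik).
Qed.

Section Eigenbasis.
Context (U : 'M[R[i]]_#|V|) (l : 'I_#|V| -> R).
Hypothesis UU1 : forall k k', \sum_j (U j k)^* * U j k' = (k == k')%:R.
Hypothesis UU2 : forall j j', \sum_k U j k * (U j' k)^* = (j == j')%:R.
Hypothesis UM : forall m i j,
  toC ((M ^+ m) i j) = \sum_k U i k * toC (l k ^+ m) * (U j k)^*.

Lemma trace_eigenvalues m : \tr (M ^+ m) = \sum_k l k ^+ m.
Proof.
apply: (@complexI R); rewrite /mxtrace !rmorph_sum /=.
under eq_bigr => i _ do rewrite UM.
rewrite exchange_big; apply: eq_bigr => k _ /=.
under eq_bigr => j _ do rewrite mulrAC mulrC mulrCA.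
transitivity (toC (l k ^+ m) * \sum_j (U j k)^* * U j k).
  by rewrite mulr_sumr; apply: eq_bigr => j _; rewrite mulrC mulrCA mulrA; ring.
by rewrite UU1 eqxx mulr1.
Qed.

(** The conjugate of column [k] of [U] is a left eigenvector of [M], and its product with column [m]
    of the Krylov matrix is l_k^m conj(U_j0k). If [U j0 k = 0], it is a nonzero row in the
    kernel. *)
Lemma krylov_eigenvector_neq0 j0 k : \det (krylov M j0) != 0 -> U j0 k != 0.
Proof.
apply: contra => /eqP Uk.
rewrite -(fmorph_eq0 toC) -det_map_mx; apply/det0P.
exists (\row_j (U j k)^*).
  apply/eqP => /rowP U0; have := UU1 k k; rewrite eqxx big1 => [/esym/eqP|j _].
    by rewrite oner_eq0.
  by have := U0 j; rewrite !mxE => ->; rewrite mul0r.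
apply/rowP => m; rewrite !mxE.
under eq_bigr => j _ do
  rewrite !mxE /= UM mulr_sumr.
rewrite exchange_big /= (bigD1 k)//= [X in X + _]big1 ?add0r; last first.
  by move=> j _; rewrite Uk conjC0 !mulr0.
rewrite big1// => k' k'k.
transitivity ((\sum_j (U j k)^* * U j k') * (toC (l k' ^+ m) * (U j0 k')^*)).
  by rewrite mulr_suml; apply: eq_bigr => j _; rewrite !mulrA.
by rewrite UU1 eq_sym (negbTE k'k) mul0r.
Qed.

(** [diag_powers M] is the matrix of the |U_jk|^2 times the Vandermonde matrix of the eigenvalues,
    so the first factor is invertible. *)
Lemma diag_powers_weights (w : 'I_#|V| -> R[i]) :
  \det (diag_powers M) != 0 ->
  (forall j, \sum_k U j k * (U j k)^* * w k = 0) -> forall k, w k = 0.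
Proof.
move=> detT w0.
pose B : 'M[R[i]]_#|V| := \matrix_(j, k) (U j k * (U j k)^*).
have detB : \det B != 0.
  have TE : map_mx toC (diag_powers M) = B *m \matrix_(k, m) toC (l k ^+ m).
    apply/matrixP => j m; rewrite !mxE /= UM; apply: eq_bigr => k _.
    by rewrite !mxE mulrAC.
  have := detT; rewrite -(fmorph_eq0 toC) -det_map_mx TE det_mulmx.
  by apply: contraNneq => ->; rewrite mul0r.
have : \col_k w k = 0 :> 'cV[R[i]]_#|V|.
  have Bu : B \in unitmx by rewrite unitmxE unitfE.
  rewrite -[LHS](mulKmx Bu).
  rewrite (_ : B *m _ = 0) ?mulmx0//.
  apply/colP => j; rewrite !mxE -[RHS](w0 j); apply: eq_bigr => k _.
  by rewrite !mxE.
by move=> /colP + k => /(_ k); rewrite !mxE.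
Qed.

Lemma eigenbasis_phase_retrieval j0 : nonresonant l ->
  (forall k, U j0 k != 0) ->
  (forall w : 'I_#|V| -> R[i],
     (forall j, \sum_k U j k * (U j k)^* * w k = 0) -> forall k, w k = 0) ->
  schrodinger_phase_retrieval (schrodinger e (potential q)).
Proof.
move=> nr Uj0 Uw T T0 u v uv.
pose a := spectral_coef U u; pose b := spectral_coef U v.
pose d k k' := a k * (a k')^* - b k * (b k')^*.
have freq j nu : \sum_(p | l p.2 - l p.1 == nu)
    U j p.1 * (U j p.2)^* * d p.1 p.2 = 0.
  apply: (cis_sum_eq0 T0) => t tT.
  have := uv t tT (enum_val j); rewrite !(evolutionE UM) => /(congr1 (fun x => x ^+ 2)).
  rewrite !normCK !rmorph_sum /= !big_distrlr /= => /eqP.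
  rewrite -subr_eq0 pair_bigA [X in _ - X]pair_bigA -sumrB => /eqP sum0.
  rewrite -[RHS]sum0; apply: eq_bigr => -[k k'] _ /=; rewrite !rmorphM /=.
  have conj_cis_num y : (cis y)^* = cis (- y) := conj_cis y.
  rewrite conj_cis_num !mulNr opprK mulrBl cisD /d -/a -/b.
  move: (cis _) (cis _) (a k) (b k) ((a k')^*) ((b k')^*) (U j k) ((U j k')^*).
  by move=> x y a1 b1 a2 b2 f g; ring.
(* By nonresonance (k, k') is the only pair with frequency [l k' - l k], so the sum in [freq] at
   [j0] has a single term, with nonzero factors from [U]. *)
have offdiag_eq k k' : k != k' -> a k * (a k')^* = b k * (b k')^*.
  move=> kk'; apply/eqP; rewrite -subr_eq0 -/(d k k').
  have := freq j0 (l k' - l k); rewrite (big_pred1 (k, k')) => [/eqP|[k1 k2]] /=.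
    by rewrite !mulf_eq0 conjC_eq0 !(negbTE (Uj0 _)).
  apply/eqP/eqP => [E|[-> ->]//]; have := nr k' k k2 k1; rewrite eq_sym kk' => /(_ isT).
  by rewrite E => /(_ erefl)[-> ->].
(* At frequency 0 only the diagonal pairs remain, which is the linear system handled by [Uw]. *)
have diag_eq k : a k * (a k)^* = b k * (b k)^*.
  apply/eqP; rewrite -subr_eq0 -/(d k k); apply/eqP.
  apply: (Uw (fun k => d k k)) => j.
  have := freq j 0; rewrite -(pair_big_dep xpredT (fun k1 k2 => l k2 - l k1 == 0)
    (fun k1 k2 => U j k1 * (U j k2)^* * d k1 k2)) /= => sum0.
  rewrite -[RHS]sum0; apply: eq_bigr => k1 _; rewrite (big_pred1 k1)// => k2 /=.
  apply/eqP/eqP => [/eqP|->]; last by rewrite subrr.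
  apply: contraTeq => k21; apply/eqP => E.
  have := nr _ _ k1 k1 k21; rewrite subrr => /(_ E)[e1].
  by rewrite e1 eqxx in k21.
have ab k k' : a k * (a k')^* = b k * (b k')^*.
  by have [->|/offdiag_eq//] := eqVneq k k'.
have decomp (w : {ffun V -> R[i]}) (i : 'I_#|V|) :
    w (enum_val i) = \sum_k U i k * spectral_coef U w k.
  rewrite /spectral_coef; under eq_bigr => k _ do rewrite mulr_sumr.
  rewrite exchange_big /= (bigD1 i)//= [X in _ + X]big1 ?addr0 => [|j ji].
    by under eq_bigr => k _ do rewrite mulrA; rewrite -mulr_suml UU2 eqxx mul1r.
  under eq_bigr => k _ do rewrite mulrA.
  by rewrite -mulr_suml UU2 eq_sym (negbTE ji) mul0r.
have collinear c : (forall k, a k = c * b k) -> u = c *: v.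
  move=> acb; apply/ffunP => x; rewrite ffunE -(enum_rankK x) !decomp.
  rewrite -[_ *: _]/(c * _) mulr_sumr; apply: eq_bigr => k _.
  by rewrite -/(a k) -/(b k) acb mulrCA.
(* If [a] vanishes then so does [b] by [ab], and [c = 1] works. *)
have [k0 ak0|a0] := pickP (fun k => a k != 0); last first.
  exists 1; rewrite normr1; split=> //; apply: collinear => k.
  have ak : a k = 0 by apply/eqP; have := a0 k; rewrite /= => /negbFE.
  rewrite ak mul1r; apply/esym/eqP; rewrite -normr_eq0 -sqrf_eq0 normCK -ab ak.
  by rewrite mul0r.
have abn : `|a k0| = `|b k0|.
  by apply/eqP; rewrite -(eqrXn2 (n := 2))// !normCK ab.
have bk0 : b k0 != 0 by rewrite -normr_eq0 -abn normr_eq0.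
(* The constant is read off from a_k conj(a_k0) = b_k conj(b_k0); [abn] gives it modulus 1. *)
exists ((b k0)^* / (a k0)^*); split.
  by rewrite normf_div !norm_conjC abn divff// normr_eq0.
apply: collinear => k.
have ak0' : (a k0)^* != 0 by rewrite conjC_eq0.
apply: (mulIf ak0'); rewrite ab mulrAC -mulrA (mulrC (b k)) mulrA.
by rewrite divfK// mulrC.
Qed.

End Eigenbasis.

Lemma schrodinger_phase_retrievalP j0 : symmetric e ->
  \det (krylov M j0) != 0 -> \det (diag_powers M) != 0 ->
  \det (ad_hankel M) != 0 ->
  schrodinger_phase_retrieval (schrodinger e (potential q)).
Proof.
move=> e_sym detK detT detA.
have [U [l [UU1 UU2 UM]]] := real_symmetric_spectral (trmx_schrodinger e_sym).
apply: (eigenbasis_phase_retrieval UU2 UM (j0 := j0)).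
- exact: ad_hankel_nonresonant (trace_eigenvalues UU1 UM) detA.
- by move=> k; exact: krylov_eigenvector_neq0 detK.
- by move=> w; exact: diag_powers_weights.
Qed.

End Retrieval.

Theorem theorem1p6 (R : realType) (V : finType) (e : rel V)
  (e_simple : simple_graph e) (e_connected : connected_graph e) :
  {ae lebesgue_measure_tuple R #|V|,
    forall q : #|V|.-tuple (measurableTypeR R),
      schrodinger_phase_retrieval (schrodinger e (potential q))}.
Proof.
(* Without vertices all states coincide; otherwise some vertex serves as the base point [j0]. *)
have [x0 _|V0] := pickP (fun _ : V => true); last first.
  apply: aeW => q T _ u v _; exists 1; rewrite normr1; split=> //.
  by apply/ffunP => x; have := V0 x.
have [e_sym _] := e_simple; pose j0 := enum_rank x0.
have n0 : (0 < #|V|)%N by exact: leq_ltn_trans (ltn_ord j0).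
have [h [h0 h1 hpath]] := adjacency_distance (R := R) j0 e_sym e_connected.
have G0 i k : 0 <= adjacency e i k :> R by rewrite mxE ler0n.
have aeK := @ae_schrodinger_det R V e _ (krylov^~ j0)
  (fun M gM => polymx_krylov gM j0) (exists_krylov G0 h1 h0 hpath).
have aeT := @ae_schrodinger_det R V e _ (@diag_powers R _)
  (fun M gM => polymx_diag_powers gM) (exists_diag_powers _).
have aeA := @ae_schrodinger_det R V e _ (@ad_hankel R _)
  (fun M gM => polymx_ad_hankel gM) (exists_ad_hankel _ n0).
by apply: filterS3 aeK aeT aeA => q; exact: schrodinger_phase_retrievalP.
Qed.
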